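(* Let $S$ be the set containing 8 copies of each odd positive integer and 4 copies of each even positive integer, and let $T$ be the set containing 4 copies of each odd positive integer, 6 copies of each positive multiple of 4, and 10 copies of each positive integer congruent to 2 modulo 4. Let $D_S(N)$ (respectively, $D_T(N)$) be the number of partitions of $N$ into distinct elements of $S$ (respectively, $T$). Then, for every integer $N\geq 1$, $$D_S(N)=2\,D_T(N).$$
   Context: A ''set containing several copies'' of certain integers means a set of colored integers: the different copies of the same integer are regarded as distinct (distinguishable) elements, each having that integer as its value. A partition of $N$ into distinct elements of $X$ is a finite subset of $X$ whose elements have values summing to $N$ (so each copy is used at most once, but different copies of the same integer may be used together, and subsets using different copies are counted as different). No restriction is imposed on the number of parts. *)

(* Defs.v *)
From mathcomp Require Import all_boot finmap.
From mathcomp Require Import boolp classical_sets functions cardinality.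

Set Implicit Arguments.
Unset Strict Implicit.
Unset Printing Implicit Defensive.

Local Open Scope classical_set_scope.
Local Open Scope nat_scope.

(* The pair (k, c) is the copy of the integer k with colour c. *)
Definition colored := (nat * nat)%type.

Definition value (x : colored) : nat := x.1.
Definition color (x : colored) : nat := x.2.

(* mult k copies of each positive integer k, with colours 0, ..., (mult k).-1 *)
Definition copies (mult : nat -> nat) : set colored :=
  [set x | 0 < value x /\ color x < mult (value x)].

Definition S_mult (k : nat) : nat := if odd k then 8 else 4.

(* In the last case k = 2 mod 4. *)
Definition T_mult (k : nat) : nat :=
  if odd k then 4 else if 4 %| k then 6 else 10.

Definition S_set : set colored := copies S_mult.
Definition T_set : set colored := copies T_mult.

Definition distinct_partitions (X : set colored) (N : nat) :
    set {fset colored} :=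
  [set P : {fset colored} | [set` P] `<=` X /\ \sum_(x <- P) value x = N].

(* fset_set A is A as a finite set when A is finite and fset0 otherwise;
   finite_distinct_partitions shows that the second case never arises for the
   sets (copies mult). *)
Definition num_distinct_partitions (X : set colored) (N : nat) : nat :=
  #|` fset_set (distinct_partitions X N)|.

Lemma finite_distinct_partitions (mult : nat -> nat) (N : nat) :
  finite_set (distinct_partitions (copies mult) N).
Proof.
pose M := \max_(k < N.+1) mult k.
pose B : {fset colored} :=
  [fset x in [seq (k, c) | k <- iota 0 N.+1, c <- iota 0 M]]%fset.
apply: (@sub_finite_set _ _ [set` fpowerset B]); last exact: finite_fset.
move=> P /= [PX PN]; rewrite fpowersetE; apply/fsubsetP => -[k c] xP.
have [/= _ ltc] := PX _ xP.
have lek : k < N.+1.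
  by rewrite ltnS -PN (big_rem _ xP) /= leq_addr.
rewrite in_fset; apply/allpairsP; exists (k, c).
rewrite !mem_iota /= !add0n; split=> //; apply: leq_trans ltc _.
exact: (leq_bigmax (Ordinal lek)).
Qed.

(* Main.v *)
Require Import Defs.
From mathcomp Require Import all_boot.
From mathcomp Require Import all_order all_algebra finmap.
From mathcomp Require Import boolp classical_sets cardinality.
From mathcomp Require Import ring zify.
From Stdlib Require Import Setoid Morphisms.

(** The two generating functions are infinite products.  Put
    a(q) = prod (1 + q^(2i+1)) and b(q) = prod (1 + q^(2i+2)), i >= 0, and write
    c = a(-q), d = a(q^2).  Sorting the integers by residue modulo 4 gives
    a^8 b^4 for S and a^4 b^6 d^4 for T, so the claim is
    a^8 b^4 + 1 = 2 a^4 b^6 d^4.  Euler's identity abc = 1 turns the term 1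
    into (abc)^4, and after division by a^4 b^4 what remains is
        a^4 + c^4 = 2 b^2 d^4.
    Multiplying by E(q^2)^2, where E(q) = prod (1 - q^(i+1)), and using
    E(q^2) b = E(q^4), Jacobi's product theta(q) = E(q^2) a(q)^2 for
    theta(q) = sum_(j in Z) q^(j^2) makes this the classical identity
        theta(q)^2 + theta(-q)^2 = 2 theta(q^2)^2.

    The latter is proved without counting lattice points.  Let D(q) be the
    difference of its two sides.  Keeping the even j gives
    theta(q) + theta(-q) = 2 theta(q^4), and the product formula gives
    theta(q) theta(-q) = theta(-q^2)^2; substituting both in
    theta(q)^2 + theta(-q)^2 = (theta(q) + theta(-q))^2 - 2 theta(q) theta(-q)
    yields D(q) = - 2 D(q^2).  As D has no constant term, this relation doubles
    the order to which D is known to vanish, so D = 0.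

    Power series are handled through truncated products and sums, compared
    modulo a power of q (the relation [cong]).  The product formula for theta
    comes from the finite form of Jacobi's identity ([jacobi_finite]), an
    exact instance of the q-binomial theorem [qbinomial]; the theta identity is
    [theta_defect_cong0], the product identity is [product_identity], and
    [num_distinct_partitions_coef] connects the products with partitions. *)

Set Implicit Arguments.
Unset Strict Implicit.
Unset Printing Implicit Defensive.

Import GRing.Theory.
Local Open Scope ring_scope.

(** * Congruences in a commutative ring *)

(** Stated with an arbitrary modulus d of an arbitrary ring so that one and the
    same lemma can be used for the bases q, -q, q^2 and q^4. *)
Definition cong (R : comNzRingType) (d x y : R) := exists r, x = y + d * r.

Lemma congxx (R : comNzRingType) (d x : R) : cong d x x.
Proof. by exists 0; rewrite mulr0 addr0. Qed.

#[local] Instance cong_equiv (R : comNzRingType) (d : R) : Equivalence (cong d).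
Proof.
split=> [x|x y [r ->]|x y z [r ->] [s ->]].
- exact: congxx.
- by exists (- r); ring.
- by exists (r + s); ring.
Qed.

#[local] Instance cong_add (R : comNzRingType) (d : R) :
  Proper (cong d ==> cong d ==> cong d) +%R.
Proof. by move=> _ y [r ->] _ y' [s ->]; exists (r + s); ring. Qed.

#[local] Instance cong_opp (R : comNzRingType) (d : R) :
  Proper (cong d ==> cong d) -%R.
Proof. by move=> _ y [r ->]; exists (- r); ring. Qed.

#[local] Instance cong_mul (R : comNzRingType) (d : R) :
  Proper (cong d ==> cong d ==> cong d) *%R.
Proof.
by move=> _ y [r ->] _ y' [s ->]; exists (y * s + r * y' + d * r * s); ring.
Qed.

#[local] Instance cong_exp (R : comNzRingType) (d : R) :
  Proper (cong d ==> eq ==> cong d) (@GRing.exp R).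
Proof.
move=> x y xy n _ <-; elim: n => [|n IH]; first exact: congxx.
by rewrite !exprS; apply: cong_mul.
Qed.

Section Congruences.
Variables (R : comNzRingType) (q : R).

Lemma cong_sum n (d : R) (F G : 'I_n -> R) :
  (forall i, cong d (F i) (G i)) ->
  cong d (\sum_(i < n) F i) (\sum_(i < n) G i).
Proof.
move=> FG; elim/big_ind2: _ => //; first exact: congxx.
by move=> *; apply: cong_add.
Qed.

Lemma cong0M (d r : R) : cong d (d * r) 0.
Proof. by exists r; rewrite add0r. Qed.

Lemma cong_trans (d y x z : R) : cong d x y -> cong d y z -> cong d x z.
Proof. by move=> ->. Qed.

Lemma cong_dvd (d e x y : R) : cong (d * e) x y -> cong d x y.
Proof. by move=> [r ->]; exists (e * r); rewrite mulrA. Qed.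

Lemma cong_expr_le m n (x y : R) :
  (m <= n)%N -> cong (q ^+ n) x y -> cong (q ^+ m) x y.
Proof. by move=> /subnKC <-; rewrite exprD; apply: cong_dvd. Qed.

Lemma cong_exprM m n k (x y : R) :
  (m <= k * n)%N -> cong ((q ^+ k) ^+ n) x y -> cong (q ^+ m) x y.
Proof. by rewrite -exprM; apply: cong_expr_le. Qed.

Lemma cong_exprN n (x y : R) : cong ((- q) ^+ n) x y -> cong (q ^+ n) x y.
Proof. by rewrite exprNn mulrC; apply: cong_dvd. Qed.

Lemma expr_cong0 m n : (m <= n)%N -> cong (q ^+ m) (q ^+ n) 0.
Proof. by move=> /subnKC <-; rewrite exprD; apply: cong0M. Qed.

(** An element congruent to 1 modulo q is invertible modulo q^n: with
    e = 1 - w and q dividing w, the geometric sum of the w^i, i < n, is an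
    inverse. *)
Lemma cong_unit_cancel n (e x y : R) :
  cong q e 1 -> cong (q ^+ n) (e * x) (e * y) -> cong (q ^+ n) x y.
Proof.
move=> [r ->]; pose w := - (q * r).
have inv : cong (q ^+ n) ((\sum_(i < n) w ^+ i) * (1 + q * r)) 1.
  have -> : (\sum_(i < n) w ^+ i) * (1 + q * r) = 1 - w ^+ n.
    by rewrite -[RHS]opprB subrX1 /w; ring.
  exists (- (- r) ^+ n); rewrite /w -mulrN exprMn; ring.
move=> exy; rewrite -[x]mul1r -[y]mul1r -inv -!mulrA exy; reflexivity.
Qed.

End Congruences.

(** * Truncated products and theta series *)

Section Products.
Variable R : comNzRingType.
Implicit Types (q : R) (n : nat).

(** In the notation of q-Pochhammer symbols [euler], [distinctprod] and [oddprod]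
    are (q; q)_n, (-q; q)_n and (-q; q^2)_n.  The product over even exponents
    is [distinctprod n (q ^+ 2)], and 1 - q^(2i+1) is the factor of
    [oddprod n (- q)]. *)
Definition euler n q := \prod_(i < n) (1 - q ^+ i.+1).
Definition distinctprod n q := \prod_(i < n) (1 + q ^+ i.+1).
Definition oddprod n q := \prod_(i < n) (1 + q ^+ i.*2.+1).

(** The sum of q^(j^2) over the integers j with |j| <= n; the terms j and -j are
    taken together so that truncations are compared at one end only. *)
Definition theta n q := 1 + \sum_(j < n) 2 * q ^+ (j.+1 ^ 2).

Lemma thetaS n q : theta n.+1 q = theta n q + 2 * q ^+ (n.+1 ^ 2).
Proof. by rewrite /theta big_ord_recr addrA. Qed.

Lemma euler_cong1 n q : cong q (euler n q) 1.
Proof.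
elim: n => [|n IH]; first by rewrite /euler big_ord0; reflexivity.
rewrite /euler big_ord_recr -/(euler n q) /= IH.
by exists (- q ^+ n); rewrite exprS; ring.
Qed.

Lemma prod_trunc m n (d : R) (F : nat -> R) :
  (forall i, (m <= i)%N -> cong d (F i) 1) -> (m <= n)%N ->
  cong d (\prod_(i < n) F i) (\prod_(i < m) F i).
Proof.
move=> F1; elim: n => [|n IH]; first by rewrite leqn0 => /eqP->; reflexivity.
rewrite leq_eqVlt => /orP[/eqP->|]; first reflexivity.
rewrite ltnS => mn; rewrite big_ord_recr /= IH // (F1 _ mn) mulr1.
reflexivity.
Qed.

Lemma euler_sqr_cong1 n q : cong q (euler n (q ^+ 2)) 1.
Proof. exact/(cong_dvd (e := q))/euler_cong1. Qed.

Lemma euler_trunc m n q : (m <= n)%N -> cong (q ^+ m) (euler n q) (euler m q).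
Proof.
apply: (prod_trunc (F := fun i => 1 - q ^+ i.+1)) => i mi.
by rewrite (expr_cong0 q (leqW mi)) subr0; reflexivity.
Qed.

Lemma oddprod_trunc m n q :
  (m <= n)%N -> cong (q ^+ m) (oddprod n q) (oddprod m q).
Proof.
apply: (prod_trunc (F := fun i => 1 + q ^+ i.*2.+1)) => i mi.
have le_m : (m <= i.*2.+1)%N by lia.
by rewrite (expr_cong0 q le_m) addr0; reflexivity.
Qed.

Lemma theta_cong1 n q : cong q (theta n q) 1.
Proof.
exists (\sum_(j < n) 2 * q ^+ (j.+1 ^ 2).-1).
rewrite /theta mulr_sumr; congr (_ + _); apply: eq_bigr => i _.
by rewrite mulrCA -exprS prednK // expn_gt0.
Qed.

Lemma theta_trunc m n q : (m <= n)%N -> cong (q ^+ m) (theta n q) (theta m q).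
Proof.
elim: n => [|n IH]; first by rewrite leqn0 => /eqP->; reflexivity.
rewrite leq_eqVlt => /orP[/eqP->|]; first reflexivity.
rewrite ltnS => mn; rewrite thetaS IH //.
have lem : (m <= n.+1 ^ 2)%N by nia.
by rewrite (expr_cong0 q lem) mulr0 addr0; reflexivity.
Qed.

(** The terms with odd j cancel, and (2i)^2 = 4 i^2. *)
Lemma theta_even_part n q :
  theta n.*2 q + theta n.*2 (- q) = 2 * theta n (q ^+ 4).
Proof.
elim: n => [|n IH]; first by rewrite /theta !big_ord0; ring.
rewrite doubleS !thetaS mulrDr -IH -exprM !(exprNn q).
rewrite -[(-1) ^+ (n.*2.+1 ^ 2)]signr_odd -[(-1) ^+ (n.*2.+2 ^ 2)]signr_odd.
rewrite !oddX /= negbK odd_double expr0 expr1.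
have -> : (n.*2.+2 ^ 2 = 4 * n.+1 ^ 2)%N by lia.
ring.
Qed.

Lemma eulerM_distinct n q : euler n q * distinctprod n q = euler n (q ^+ 2).
Proof.
rewrite -big_split; apply: eq_bigr => i _ /=.
by rewrite -exprM mulnC exprM; ring.
Qed.

Lemma prod_double n (F : nat -> R) :
  \prod_(i < n.*2) F i = \prod_(i < n) F i.*2 * \prod_(i < n) F i.*2.+1.
Proof.
elim: n => [|n IH]; first by rewrite !big_ord0 mulr1.
by rewrite doubleS !big_ord_recr /= IH; ring.
Qed.

Lemma euler_double n q : euler n.*2 q = euler n (q ^+ 2) * oddprod n (- q).
Proof.
rewrite /euler (prod_double n (fun i => 1 - q ^+ i.+1)) mulrC; congr (_ * _).
  by apply: eq_bigr => i _; rewrite -exprM -doubleS -muln2 mulnC.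
apply: eq_bigr => i _.
by rewrite (exprNn q) -signr_odd /= odd_double expr1 mulN1r.
Qed.

Lemma distinct_double n q :
  distinctprod n.*2 q = oddprod n q * distinctprod n (q ^+ 2).
Proof.
rewrite /distinctprod (prod_double n (fun i => 1 + q ^+ i.+1)); congr (_ * _).
by apply: eq_bigr => i _; rewrite -exprM -doubleS -muln2 mulnC.
Qed.

Lemma oddprodN n q : oddprod n q * oddprod n (- q) = oddprod n (- q ^+ 2).
Proof.
rewrite -big_split; apply: eq_bigr => i _ /=.
rewrite (exprNn q) (exprNn (q ^+ 2)) -signr_odd /= odd_double expr1.
by rewrite -exprM mulnC exprM; ring.
Qed.

(** Euler's theorem on partitions into odd and into distinct parts: the first
    two factors make up the product of all 1 + q^i, and 1 - q^(2i+1) is left of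
    the product of all 1 - q^i once the even i are divided out. *)
Lemma euler_distinct_odd n q :
  cong (q ^+ n) (oddprod n q * distinctprod n (q ^+ 2) * oddprod n (- q)) 1.
Proof.
apply: (cong_unit_cancel (euler_sqr_cong1 n q)); rewrite mulr1.
have -> : euler n (q ^+ 2) *
    (oddprod n q * distinctprod n (q ^+ 2) * oddprod n (- q)) =
  euler n.*2 (q ^+ 2).
  by rewrite -(eulerM_distinct n.*2) distinct_double euler_double; ring.
apply: (@cong_exprM _ q n n 2); first lia.
by apply: euler_trunc; lia.
Qed.

Lemma prod_odd_powers n q : \prod_(i < n) q ^+ i.*2.+1 = q ^+ (n ^ 2).
Proof.
elim: n => [|n IH]; first by rewrite big_ord0.
by rewrite big_ord_recr /= IH -exprD; congr (q ^+ _); lia.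
Qed.

(** * The q-binomial theorem and Jacobi's product for theta *)

(** The Gaussian binomial coefficients, defined by Pascal's rule because the
    quotient of q-factorials cannot be formed in a ring; [qbin_euler] recovers
    the quotient as a product formula. *)
Fixpoint qbin n k q : R :=
  match n, k with
  | _, 0 => 1
  | 0, _.+1 => 0
  | n'.+1, k'.+1 => qbin n' k' q + q ^+ k * qbin n' k q
  end.

Lemma qbinn0 n q : qbin n 0 q = 1. Proof. by case: n. Qed.

Lemma qbin_small n k q : (n < k)%N -> qbin n k q = 0.
Proof.
elim: n k => [|n IH] [|k] //= nk; rewrite !IH ?mulr0 ?addr0 //; lia.
Qed.

Lemma qbin_euler k m q :
  qbin (k + m) k q * (euler k q * euler m q) = euler (k + m) q.
Proof.
have rec j : euler j.+1 q = euler j q * (1 - q ^+ j.+1).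
  by rewrite /euler big_ord_recr.
have e0 : euler 0 q = 1 by rewrite /euler big_ord0.
move: {2}(k + m)%N (leqnn (k + m)%N) => s.
elim: s k m => [|s IH] [|k] [|m] // le_s;
  rewrite ?e0 ?add0n ?qbinn0 ?mul1r //.
- have IHk := IH k 0%N ltac:(lia).
  move: IHk; rewrite !addn0 !rec /= (qbin_small _ (ltnSn k)) e0 => IHk.
  by rewrite -{2}IHk; ring.
- have IH1 := IH k m.+1 ltac:(lia); have IH2 := IH k.+1 m ltac:(lia).
  rewrite addSnnS in IH2; rewrite addSn (rec (k + m.+1)%N).
  have -> : qbin (k + m.+1).+1 k.+1 q =
    qbin (k + m.+1) k q + q ^+ k.+1 * qbin (k + m.+1) k.+1 q by [].
  rewrite -addSn exprD.
  (* The two terms of Pascal's rule contribute the two summands of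
     1 - q^(k+m+2) = (1 - q^(k+1)) + q^(k+1) (1 - q^(m+1)). *)
  have -> : euler (k + m.+1) q * (1 - q ^+ k.+1 * q ^+ m.+1) =
    (1 - q ^+ k.+1) * euler (k + m.+1) q +
    q ^+ k.+1 * (1 - q ^+ m.+1) * euler (k + m.+1) q by ring.
  by rewrite -{1}IH1 -IH2 (rec k) (rec m); ring.
Qed.

(** Splitting off the factor i = 0 leaves the same product with x q in place of
    x, so that the coefficients follow the form of Pascal's rule in [qbin]. *)
Lemma qbinomial n (x y q : R) :
  \prod_(i < n) (y + x * q ^+ i) =
  \sum_(k < n.+1) q ^+ 'C(k, 2) * qbin n k q * x ^+ k * y ^+ (n - k).
Proof.
elim: n x => [|n IH] x.
  by rewrite big_ord0 big_ord_recr big_ord0 /= !expr0; ring.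
rewrite big_ord_recl expr0 mulr1.
have -> : \prod_(i < n) (y + x * q ^+ (lift ord0 i)) =
          \prod_(i < n) (y + (x * q) * q ^+ i).
  by apply: eq_bigr => i _; rewrite lift0 exprS mulrA.
rewrite IH mulrDl [RHS]big_ord_recl subn0.
pose f k := q ^+ 'C(k, 2) * qbin n k q * (x * q) ^+ k * y ^+ (n - k).
have -> : x * (\sum_(k < n.+1) f k) =
   \sum_(k < n.+1) q ^+ 'C(k.+1, 2) * qbin n k q * x ^+ k.+1 * y ^+ (n - k).
  rewrite mulr_sumr; apply: eq_bigr => k _.
  by rewrite /f binS bin1 exprD exprMn exprS; ring.
have -> : y * (\sum_(k < n.+1) f k) =
   y ^+ n.+1 + \sum_(k < n.+1)
     q ^+ 'C(k.+1, 2) * (q ^+ k.+1 * qbin n k.+1 q) * x ^+ k.+1 * y ^+ (n - k).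
  rewrite /f big_ord_recl big_ord_recr /= (qbin_small _ (ltnSn n)) !qbinn0 subn0.
  rewrite mulrDr mulr_sumr; congr (_ + _); first by rewrite exprS; ring.
  rewrite !(mulr0, mul0r) addr0; apply: eq_bigr => k _; rewrite /bump /= add1n.
  have -> : (n - k = (n - k.+1).+1)%N by have := ltn_ord k; lia.
  by rewrite exprMn [y ^+ _.+1]exprS; ring.
rewrite -addrA -big_split /=; congr (_ + _); first by rewrite !expr0; ring.
by apply: eq_bigr => k _; rewrite subSS; ring.
Qed.

End Products.

Section Jacobi.
Variables (R : idomainType) (q : R).
Hypothesis q_neq0 : q != 0.
Local Notation dist k n := ((k - n) + (n - k))%N.

(** The q-binomial theorem with base q^2, 2n factors, x = q and y = q^(2n), after
    division by q^(3n^2).  The factors q^(2n) + q^(2i+1) with i < n give one copy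
    of [oddprod n q] when q^(2i+1) is taken out, those with i >= n the other
    copy when q^(2n) is taken out; on the right the exponents are
    k^2 + 2n (2n - k) = 3n^2 + (k - n)^2. *)
Lemma jacobi_finite n :
  oddprod n q ^+ 2 =
  \sum_(k < n.*2.+1) qbin n.*2 k (q ^+ 2) * q ^+ (dist k n ^ 2).
Proof.
apply: (mulfI (expf_neq0 (3 * n ^ 2) q_neq0)).
transitivity (\prod_(i < n + n) (q ^+ n.*2 + q * (q ^+ 2) ^+ i)).
  rewrite big_split_ord /= (reindex_inj rev_ord_inj) /=.
  have -> : \prod_(i < n) (q ^+ n.*2 + q * (q ^+ 2) ^+ (n - i.+1)) =
            q ^+ (n ^ 2) * oddprod n q.
    rewrite -(prod_odd_powers n) [in RHS](reindex_inj rev_ord_inj) /= -big_split.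
    apply: eq_bigr => i _ /=; rewrite mulrDr mulr1 -exprD -exprM -exprS addrC.
    by congr (q ^+ _ + q ^+ _); have := ltn_ord i; lia.
  have -> : \prod_(i < n) (q ^+ n.*2 + q * (q ^+ 2) ^+ (n + i)) =
            q ^+ (n.*2 * n) * oddprod n q.
    have -> : q ^+ (n.*2 * n) = \prod_(i < n) q ^+ n.*2.
      by rewrite prodr_const card_ord exprM.
    rewrite -big_split; apply: eq_bigr => i _ /=.
    rewrite mulrDr mulr1 -exprD -exprM -exprS; congr (_ + q ^+ _); lia.
  have -> : q ^+ (3 * n ^ 2) = q ^+ (n ^ 2) * q ^+ (n.*2 * n).
    by rewrite -exprD; congr (q ^+ _); lia.
  ring.
rewrite addnn qbinomial mulr_sumr; apply: eq_bigr => k _.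
transitivity (qbin n.*2 k (q ^+ 2) *
    ((q ^+ 2) ^+ 'C(k, 2) * q ^+ k * (q ^+ n.*2) ^+ (n.*2 - k))).
  by rewrite -!mulrA mulrCA.
rewrite [RHS]mulrCA -!exprM -!exprD; congr (_ * q ^+ _).
have sq (m : nat) : (2 * 'C(m, 2) + m = m ^ 2)%N.
  by elim: m => // m IHm; rewrite binS bin1; lia.
rewrite sq; move: (nat_of_ord k) (ltn_ord k) => {}k; rewrite ltnS => le_k.
have [le_kn|lt_nk] := leqP k n.
  have [j ->] : exists j, n = (k + j)%N by exists (n - k)%N; lia.
  have -> : dist k (k + j) = j by lia.
  have -> : ((k + j).*2 - k = k + j.*2)%N by lia.
  by rewrite -!muln2; ring.
have [j ej] : exists j, k = (n + j)%N by exists (k - n)%N; lia.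
have [i ei] : exists i, n = (j + i)%N by exists (n - j)%N; lia.
have -> : dist k n = j by lia.
have -> : (n.*2 - k = i)%N by lia.
by rewrite ej ei -!muln2; ring.
Qed.

Lemma sum_dist_theta n : \sum_(k < n.*2.+1) q ^+ (dist k n ^ 2) = theta n q.
Proof.
elim: n => [|n IH]; first by rewrite /theta big_ord1 big_ord0 expr0 addr0.
rewrite doubleS big_ord_recl big_ord_recr /=.
rewrite thetaS -IH sub0n subn0 add0n.
have -> : dist n.*2.+2 n.+1 = n.+1 by lia.
have -> : \sum_(i < n.*2.+1) q ^+ (dist (bump 0 i) n.+1 ^ 2) =
  \sum_(k < n.*2.+1) q ^+ (dist k n ^ 2).
  by apply: eq_bigr => i _; rewrite /bump /= add1n !subSS.
ring.
Qed.

(** With j = |k - n|, both k and 2n - k are at least n - j, so the Gaussian binomial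
    in [jacobi_finite] times [euler n (q ^+ 2)] is 1 up to order 2(n - j) in q.
    The weight q^(j^2) makes up for the loss of precision at large j. *)
Lemma theta_prod n :
  cong (q ^+ n) (euler n (q ^+ 2) * oddprod n q ^+ 2) (theta n q).
Proof.
rewrite jacobi_finite -sum_dist_theta mulr_sumr; apply: cong_sum => k.
set j := dist k n; pose m := (n.*2 - k)%N.
have := ltn_ord k; rewrite ltnS => lek.
have em : (k + m = n.*2)%N by rewrite subnKC.
have [r er] :
    cong (q ^+ (2 * (n - j))) (euler n (q ^+ 2) * qbin n.*2 k (q ^+ 2)) 1.
  apply: (cong_unit_cancel (euler_sqr_cong1 n q)); rewrite mulr1 exprM.
  have := qbin_euler k m (q ^+ 2); rewrite em => qe.
  have tr a : (n - j <= a)%N ->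
      cong ((q ^+ 2) ^+ (n - j)) (euler a (q ^+ 2)) (euler n (q ^+ 2)).
    move=> le_a; rewrite (euler_trunc _ le_a) (euler_trunc _ (leq_subr j n)).
    reflexivity.
  apply: (cong_trans _ (tr n.*2 _)); last by lia.
  rewrite -qe (tr k); last by rewrite /j; lia.
  rewrite (tr m); last by rewrite /j; lia.
  by exists 0; ring.
have -> : euler n (q ^+ 2) * (qbin n.*2 k (q ^+ 2) * q ^+ (j ^ 2)) =
   q ^+ (j ^ 2) + q ^+ (2 * (n - j) + j ^ 2) * r by rewrite mulrA er exprD; ring.
have le_n : (n <= 2 * (n - j) + j ^ 2)%N.
  have : (j <= n)%N by rewrite /j; lia.
  by case: (j) => [|[|i]]; nia.
by rewrite (expr_cong0 q le_n) mul0r addr0; reflexivity.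
Qed.

End Jacobi.

(** * The theta and product identities *)

Section ThetaIdentity.
Variable R : idomainType.
Implicit Types (q : R) (n : nat).

Lemma theta_prodN n q : q != 0 ->
  cong (q ^+ n) (euler n (q ^+ 2) * oddprod n (- q) ^+ 2) (theta n (- q)).
Proof.
move=> q0; apply: cong_exprN; rewrite -sqrrN; apply: theta_prod.
by rewrite oppr_eq0.
Qed.

(** In products: a(q) a(-q) = a(-q^2) and E(q^2) = E(q^4) a(-q^2), so both sides
    are E(q^4)^2 a(-q^2)^4. *)
Lemma thetaM_thetaN n q : q != 0 ->
  cong (q ^+ n) (theta n q * theta n (- q)) (theta n (- q ^+ 2) ^+ 2).
Proof.
move=> q0.
have t : cong (q ^+ n)
    (euler n (q ^+ 4) * oddprod n (- q ^+ 2) ^+ 2) (theta n (- q ^+ 2)).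
  apply: (@cong_exprM _ q n n 2); first by lia.
  rewrite (_ : q ^+ 4 = (q ^+ 2) ^+ 2); last by ring.
  by apply: theta_prodN; rewrite expf_neq0.
have e : cong (q ^+ n)
    (euler n (q ^+ 2)) (euler n (q ^+ 4) * oddprod n (- q ^+ 2)).
  rewrite (_ : q ^+ 4 = (q ^+ 2) ^+ 2); last by ring.
  rewrite -euler_double; apply: (@cong_exprM _ q n n 2); first by lia.
  by symmetry; apply: euler_trunc; lia.
rewrite -(theta_prod q0) -(theta_prodN n q0) -t e -(oddprodN n q).
by exists 0; ring.
Qed.

Definition theta_defect n q :=
  theta n q ^+ 2 + theta n (- q) ^+ 2 - 2 * theta n (q ^+ 2) ^+ 2.

Lemma theta_defect_rec n q : q != 0 ->
  cong (q ^+ n) (theta_defect n q) (- 2 * theta_defect n (q ^+ 2)).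
Proof.
move=> q0.
have s : cong (q ^+ n) (theta n q + theta n (- q)) (2 * theta n (q ^+ 4)).
  rewrite -theta_even_part.
  have tr (x : R) : cong (x ^+ n) (theta n x) (theta n.*2 x).
    by symmetry; apply: theta_trunc; lia.
  by rewrite (tr q) (cong_exprN (tr (- q))); reflexivity.
have -> : theta_defect n q = (theta n q + theta n (- q)) ^+ 2
   - 2 * (theta n q * theta n (- q)) - 2 * theta n (q ^+ 2) ^+ 2.
  by rewrite /theta_defect; ring.
rewrite s (thetaM_thetaN n q0) /theta_defect -[(q ^+ 2) ^+ 2]exprM.
by exists 0; ring.
Qed.

(** If the defect vanishes to order m >= 1 for every base, then at base q^2 it
    vanishes to order 2m >= m + 1 in q, and [theta_defect_rec] carries this over
    to base q. *)
Lemma theta_defect_cong0 n q : q != 0 -> cong (q ^+ n) (theta_defect n q) 0.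
Proof.
suff H m :
    (m <= n)%N -> forall q, q != 0 -> cong (q ^+ m) (theta_defect n q) 0.
  by apply: H.
elim: m => [|m IH] le_mn {}q q0.
  by exists (theta_defect n q); rewrite expr0 mul1r add0r.
case: m => [|m] in IH le_mn *.
  rewrite expr1 /theta_defect.
  have tN : cong q (theta n (- q)) 1.
    by apply: (@cong_exprN _ _ 1); apply: theta_cong1.
  have t2 : cong q (theta n (q ^+ 2)) 1.
    exact/(cong_dvd (e := q))/theta_cong1.
  by rewrite theta_cong1 tN t2; exists 0; ring.
rewrite (cong_expr_le le_mn (theta_defect_rec n q0)).
have := IH (ltnW le_mn) _ (expf_neq0 2 q0).
move=> /(@cong_exprM _ q m.+2) -> //; last by lia.
by exists 0; ring.
Qed.

(** The theta identity in product form, multiplied by a^4 b^4, with the constant 1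
    standing for (abc)^4. *)
Lemma product_identity n q : q != 0 ->
  cong (q ^+ n)
    (oddprod n q ^+ 8 * distinctprod n (q ^+ 2) ^+ 4 + 1)
    (2 * (oddprod n q ^+ 4 * distinctprod n (q ^+ 2) ^+ 6 *
      oddprod n (q ^+ 2) ^+ 4)).
Proof.
move=> q0; set a := oddprod n q; set b := distinctprod n (q ^+ 2).
set d := oddprod n (q ^+ 2); pose c := oddprod n (- q).
have abc : cong (q ^+ n) (a * b * c) 1 := euler_distinct_odd n q.
pose E := euler n (q ^+ 2).
have e1 : cong q (E ^+ 2) 1.
  by rewrite (euler_sqr_cong1 n q : cong q E 1) expr1n; reflexivity.
have t1 : cong (q ^+ n) (E * a ^+ 2) (theta n q) := theta_prod q0 n.
have t2 : cong (q ^+ n) (E * c ^+ 2) (theta n (- q)) := theta_prodN n q0.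
have t3 : cong (q ^+ n) (E * b * d ^+ 2) (theta n (q ^+ 2)).
  rewrite /E eulerM_distinct; apply: (@cong_exprM _ q n n 2); first by lia.
  by apply: theta_prod; rewrite expf_neq0.
have quartic : cong (q ^+ n) (a ^+ 4 + c ^+ 4) (2 * b ^+ 2 * d ^+ 4).
  apply: (cong_unit_cancel e1).
  have := theta_defect_cong0 n q0.
  rewrite /theta_defect -t1 -t2 -t3 => def0.
  transitivity (E ^+ 2 * (2 * b ^+ 2 * d ^+ 4) + 0); last first.
    by rewrite addr0; reflexivity.
  by rewrite -def0; exists 0; ring.
have -> : 2 * (a ^+ 4 * b ^+ 6 * d ^+ 4) =
          a ^+ 4 * b ^+ 4 * (2 * b ^+ 2 * d ^+ 4) by ring.
rewrite -quartic.
have -> : a ^+ 4 * b ^+ 4 * (a ^+ 4 + c ^+ 4) =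
          a ^+ 8 * b ^+ 4 + (a * b * c) ^+ 4 by ring.
by rewrite abc expr1n; reflexivity.
Qed.

End ThetaIdentity.

(** * Generating functions of partitions into distinct coloured parts *)

Lemma prod_add1_fset (R : comNzRingType) (I : choiceType) (B : {fset I})
    (F : I -> R) :
  \prod_(x <- B) (1 + F x) = \sum_(P <- fpowerset B) \prod_(x <- P) F x.
Proof.
rewrite big_seq_fsetE /= /fpowerset big_imfset /=; last first.
  move=> X Y _ _ /fsetP eqXY; apply/setP => x.
  by have := eqXY (val x); rewrite !inE.
under eq_bigr => x _ do rewrite addrC.
rewrite bigA_distr big_enum /=; apply: eq_big => [J|J _].
  by rewrite powersetE finset.subsetT.
rewrite big_imfset /=; last by move=> x y _ _; apply: val_inj.
by rewrite big_enum [RHS]big_mkcond.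
Qed.

Lemma coef_prod_fset (R : comNzRingType) (B : {fset colored}) (N : nat) :
  (\prod_(x <- B) (1 + 'X^(value x)) : {poly R})`_N =
  #|` [fset P in fpowerset B | \sum_(x <- P) value x == N]%N%fset|%:R.
Proof.
rewrite prod_add1_fset coef_sum card_fset_sum1 big_fset /= natr_sum.
rewrite [RHS]big_mkcond /=; apply: eq_bigr => P _.
rewrite -(big_morph (fun n => 'X^n : {poly R}) (exprD _) (expr0 _)).
by rewrite coefXn eq_sym; case: eqP.
Qed.

(** A partition of N has no part above N, so the copies of 1, ..., L form a finite
    set whose subsets include every partition that is counted. *)
Lemma num_distinct_partitions_coef (R : comNzRingType) (mult : nat -> nat)
    (L N : nat) :
  (N <= L)%N ->
  (num_distinct_partitions (copies mult) N)%:R =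
  (\prod_(i < L) (1 + 'X^(i.+1)) ^+ mult i.+1 : {poly R})`_N.
Proof.
move=> leNL.
pose s : seq colored :=
  [seq (i.+1, c) | i <- iota 0 L, c <- iota 0 (mult i.+1)].
pose B := [fset x in s]%fset.
have inB k c : ((k, c) \in B) = [&& 0 < k, k <= L & c < mult k]%N.
  rewrite in_fset /=; apply/allpairsPdep/idP => [[i [c' []]]|].
    by rewrite !mem_iota /= !add0n => ? ? [-> ->]; apply/and3P; split; lia.
  case: k => [|k] /and3P[// _ lek ltc]; exists k, c.
  by rewrite !mem_iota !add0n.
have uniq_s : uniq s.
  apply: allpairs_uniq_dep => [|i _|]; rewrite ?iota_uniq //.
  by move=> [i c] [i' c'] /= _ _ [-> ->].
transitivity ((\prod_(x <- B) (1 + 'X^(value x)) : {poly R})`_N); last first.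
  congr (polyseq _)`_N.
  have sB : perm_eq B s.
    by apply: uniq_perm => // x; rewrite in_fset.
  rewrite (perm_big _ sB) /= big_allpairs_dep /=.
  have -> : iota 0 L = index_iota 0 L by rewrite /index_iota subn0.
  rewrite big_mkord; apply: eq_bigr => i _.
  by rewrite big_const_seq count_predT size_iota -Monoid.iteropE.
rewrite coef_prod_fset; congr (_%:R); congr (#|` _|); apply/fsetP => P.
rewrite in_fset_set; last exact: finite_distinct_partitions.
rewrite !inE fpowersetE /=; apply/idP/andP.
  rewrite inE => -[PX PN]; split; last exact/eqP.
  apply/fsubsetP => -[k c] xP; have [/= k0 ltc] := PX _ xP.
  rewrite inB k0 ltc andbT /=; apply: leq_trans leNL.
  by rewrite -PN (big_rem _ xP) /= leq_addr.
move=> [/fsubsetP PB /eqP PN]; rewrite inE; split=> // -[k c] /= /PB.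
by rewrite inB => /and3P[].
Qed.

Lemma cong_coef (R : comNzRingType) (n i : nat) (p r : {poly R}) :
  (i < n)%N -> cong ('X^n) p r -> p`_i = r`_i.
Proof. by move=> ltin [u ->]; rewrite coefD coefXnM ltin addr0. Qed.

Lemma gf_S (R : comNzRingType) (q : R) n :
  \prod_(i < n.*2) (1 + q ^+ i.+1) ^+ S_mult i.+1 =
  oddprod n q ^+ 8 * distinctprod n (q ^+ 2) ^+ 4.
Proof.
rewrite (prod_double n (fun i => (1 + q ^+ i.+1) ^+ S_mult i.+1)) -!prodrXl.
congr (_ * _); apply: eq_bigr => i _; rewrite /S_mult /= odd_double //=.
by rewrite -exprM -doubleS -muln2 mulnC.
Qed.

Lemma gf_T (R : comNzRingType) (q : R) n :
  \prod_(i < n.*2.*2) (1 + q ^+ i.+1) ^+ T_mult i.+1 =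
  oddprod n.*2 q ^+ 4 * distinctprod n.*2 (q ^+ 2) ^+ 6 *
  oddprod n (q ^+ 2) ^+ 4.
Proof.
rewrite (prod_double n.*2 (fun i => (1 + q ^+ i.+1) ^+ T_mult i.+1)).
rewrite (prod_double n (fun i => (1 + q ^+ i.*2.+2) ^+ T_mult i.*2.+2)).
rewrite (distinct_double n).
transitivity (oddprod n.*2 q ^+ 4 *
    (oddprod n (q ^+ 2) ^+ 10 * distinctprod n ((q ^+ 2) ^+ 2) ^+ 6)); last by ring.
rewrite -!prodrXl; congr (_ * (_ * _)); apply: eq_bigr => i _; rewrite /T_mult /=.
- by rewrite odd_double.
- rewrite !odd_double (_ : (4 %| i.*2.*2.+2)%N = false); last by lia.
  by rewrite -exprM; congr ((1 + q ^+ _) ^+ _); lia.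
- rewrite odd_double /= (_ : (4 %| i.*2.+1.*2.+2)%N = true); last by lia.
  by rewrite -!exprM; congr ((1 + q ^+ _) ^+ _); lia.
Qed.

(** The product over 2 mod 4 in [gf_T] has half as many factors as
    [product_identity] provides at level 2n; the surplus factors are 1 modulo
    X^n. *)
Lemma gf_identity (R : idomainType) n :
  cong ('X^n : {poly R})
    (\prod_(i < n.*2.*2) (1 + 'X^(i.+1)) ^+ S_mult i.+1 + 1)
    (2 * \prod_(i < n.*2.*2) (1 + 'X^(i.+1)) ^+ T_mult i.+1).
Proof.
have X0 : 'X != 0 :> {poly R} by rewrite polyX_eq0.
have le_n : (n <= n.*2)%N by lia.
rewrite gf_S gf_T (cong_expr_le le_n (product_identity n.*2 X0)).
have tr := @oddprod_trunc _ n n.*2 ('X^2 : {poly R}) le_n.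
by rewrite (@cong_exprM _ _ n n 2 _ _ _ tr); [reflexivity | lia].
Qed.

Local Close Scope ring_scope.

Theorem theorem3p15 (N : nat) (hN : 1 <= N) :
  num_distinct_partitions S_set N = 2 * num_distinct_partitions T_set N.
Proof.
have leN : (N <= N.+1.*2.*2)%N by lia.
have := cong_coef (ltnSn N) (gf_identity int N.+1).
rewrite coefD mulr_natl coefMn coef1 -!num_distinct_partitions_coef //.
rewrite (gtn_eqF hN) addr0 -mulrnA => /eqP.
by rewrite Num.Theory.eqr_nat mulnC => /eqP.
Qed.
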